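(* Let $S\subseteq G\setminus\{0\}$ be non-empty, $p\in(0,\infty)$, and let $\mu_0,\mu_n\in\mathcal M$ $(n\in\mathbb N)$ be such that $\mu_0\ll\mu_n$ for all $n\in\mathbb N$ and the metric projections $\phi_{\mu_k,p}(S)$, $k\in\mathbb N_0$, exist. Suppose $d_p(\mu_0;S)=0$. If $\lim_{n\to\infty}d_p(\mu_n,\mu_0;S)=d_p(\mu_0;S)$, then $\lim_{n\to\infty}\int|\phi_{\mu_0,p}(S)-\phi_{\mu_n,p}(S)|^p\,d\mu_0=0$.
   Context: $G$ is a locally compact abelian Hausdorff group (written additively), $\Gamma$ is its dual group, and for $x\in G$, $e_x:\Gamma\to\mathbb C$ denotes the character of $\Gamma$ generated by $x$. $\mathcal M$ is the set of all non-zero finite non-negative regular Borel measures on $\Gamma$. For a non-empty set $S\subseteq G\setminus\{0\}$, $\mathcal T(S)$ is the complex linear space of all finite sums $\sum_j a_je_{x_j}$ with $a_j\in\mathbb C$, $x_j\in S$. For $\mu\in\mathcal M$ and $p\in(0,\infty)$, $d_p(\mu;S):=\inf\{\int|1-\tau|^p\,d\mu:\tau\in\mathcal T(S)\}$, and $[\mathcal T(S)]_{\mu,p}$ is the closure of $\mathcal T(S)$ in $L^p(\mu)$. If there is a unique element $\phi_{\mu,p}(S)\in[\mathcal T(S)]_{\mu,p}$ with $d_p(\mu;S)=\int|1-\phi_{\mu,p}(S)|^p\,d\mu$, it is called the metric projection of $1$ and one says that $\phi_{\mu,p}(S)$ exists. If $\mu\ll\nu$ and $\phi_{\nu,p}(S)$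 exists, $d_p(\nu,\mu;S):=\int|1-\phi_{\nu,p}(S)|^p\,d\mu\in[0,\infty]$. *)

(* Defs.v *)
From HB Require Import structures.
From mathcomp Require Import all_boot all_order all_algebra.
From mathcomp Require Import all_classical all_reals all_analysis.
From mathcomp Require Export complex.

Set Implicit Arguments.
Unset Strict Implicit.
Unset Printing Implicit Defensive.

Import Order.TTheory GRing.Theory Num.Theory.
Import numFieldNormedType.Exports.
Import ComplexField.Normc.

Local Open Scope classical_set_scope.
Local Open Scope ring_scope.

(* The dual group of G: continuous homomorphisms into the unit circle. [R[i]^o]
   is [R[i]] with the topology given by the modulus. *)
Record dual (R : realType) (G : topologicalZmodType) := Dual {
  dual_fun :> G -> R[i];
  dualD : forall x y, dual_fun (x + y) = dual_fun x * dual_fun y;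
  norm_dual : forall x, `|dual_fun x| = 1;
  continuous_dual : continuous (dual_fun : G -> R[i]^o) }.

Section dual_instances.
Variables (R : realType) (G : topologicalZmodType).

Let dual1D (x y : G) : cst (1 : R[i]) (x + y) = cst 1 x * cst 1 y.
Proof. by rewrite mulr1. Qed.

Let norm_dual1 (x : G) : `|cst (1 : R[i]) x| = 1.
Proof. exact: normr1. Qed.

Let continuous_dual1 : continuous (cst (1 : R[i]) : G -> R[i]^o).
Proof. exact: cst_continuous. Qed.

Definition dual1 : dual R G := Dual dual1D norm_dual1 continuous_dual1.

HB.instance Definition _ := gen_eqMixin (dual R G).
HB.instance Definition _ := gen_choiceMixin (dual R G).
HB.instance Definition _ := isPointed.Build (dual R G) dual1.

HB.instance Definition _ :=
  Topological.copy (dual R G)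
    (initial_topology
       (fun g : dual R G => (g : {compact-open, G -> R[i]^o}))).

HB.instance Definition _ :=
  Measurable.copy (dual R G) (g_sigma_algebraType (@open (dual R G))).

End dual_instances.

Definition char_of (R : realType) (G : topologicalZmodType) (x : G) :
  dual R G -> R[i] := fun g => g x.

Section regular_measures.
Variables (R : realType) (G : topologicalZmodType).

Definition regular_measure (mu : set (dual R G) -> \bar R) :=
  forall A, measurable A ->
    mu A = ereal_inf [set mu U | U in [set U | open U /\ A `<=` U]] /\
    mu A = ereal_sup [set mu K | K in [set K | compact K /\ K `<=` A]].

Definition regular_nonzero : set {finite_measure set (dual R G) -> \bar R} :=
  [set mu | regular_measure mu /\ mu setT != 0%E].

End regular_measures.

Section approximation.
Context d (T : measurableType d) (R : realType).
Implicit Types (mu : {measure set T -> \bar R}) (p : R) (f g : T -> R[i])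
  (V : set (T -> R[i])).

Definition complex_measurable f :=
  measurable_fun setT (fun t => complex.Re (f t)) /\
  measurable_fun setT (fun t => complex.Im (f t)).

(* For every p > 0 the topology of L^p(mu) is the one in which f is close to g when
   [Lp_int mu p (f \- g)] is small: no p-th root is needed, even when p >= 1. *)
Definition Lp_int mu p f : \bar R := \int[mu]_t (normc (f t) `^ p)%:E.

(* Elements of L^p(mu) are represented by functions, identified when they agree
   almost everywhere. *)
Definition Lp mu p : set (T -> R[i]) :=
  [set f | complex_measurable f /\ (Lp_int mu p f < +oo)%E].

Definition Lp_closure mu p V : set (T -> R[i]) :=
  [set f | Lp mu p f /\
    forall e : R, 0 < e -> exists2 g, V g & (Lp_int mu p (f \- g)%R < e%:E)%E].

(* d_p(mu; S) is [best_error mu p (trig_poly S)]; if f represents the metric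
   projection for nu and mu `<< nu, then d_p(nu, mu; S) is
   [Lp_int mu p (cst 1 \- f)], whatever the representative f. *)
Definition best_error mu p V : \bar R :=
  ereal_inf [set Lp_int mu p (cst 1 \- g) | g in V].

(* f represents the metric projection of 1: the element of the closure of V, unique
   up to mu-almost everywhere equality, at which the best error is attained. *)
Definition is_metric_projection mu p V f :=
  [/\ Lp_closure mu p V f,
      best_error mu p V = Lp_int mu p (cst 1 \- f) &
      forall g, Lp_closure mu p V g ->
        best_error mu p V = Lp_int mu p (cst 1 \- g) -> g = f %[ae mu]].

End approximation.

Definition trig_poly (R : realType) (G : topologicalZmodType) (S : set G) :
    set (dual R G -> R[i]) :=
  [set f | exists (n : nat) (a : 'I_n -> R[i]) (x : 'I_n -> G),
    (forall j, S (x j)) /\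
    f = fun g => \sum_(j < n) a j * char_of (x j) g].

(* Main.v *)
Require Import Defs.
From mathcomp Require Import all_boot all_order all_algebra.
From mathcomp Require Import all_classical all_reals all_analysis.
From mathcomp Require Import measurable_realfun.

Import Order.TTheory GRing.Theory Num.Theory.
Import numFieldNormedType.Exports.

Local Open Scope classical_set_scope.
Local Open Scope ring_scope.

(** The metric projection of 1 for [mu 0] lies at distance 0 from 1, and the
    integral of a non-negative function vanishes only if the function does
    almost everywhere; hence [phi 0] is the constant 1 up to a null set of
    [mu 0] ([Lp_int_eq0_ae]).  Integrals against [mu 0] do not see null sets
    ([eq_Lp_int_ae]), so the quantities in the conclusion are, term by term,
    those in the hypothesis, and the two limits are the same.  No
    triangle inequality enters, so p < 1 and p >= 1 are treated alike. *)

Section Lp_int_ae.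
Context d (T : measurableType d) (R : realType).
Implicit Types (mu : {measure set T -> \bar R}) (p : R) (f g : T -> R[i]).

Lemma complex_measurable_cst (z : R[i]) :
  complex_measurable (cst z : T -> R[i]).
Proof. by split; exact: measurable_cst. Qed.

Lemma complex_measurableB f g :
  complex_measurable f -> complex_measurable g -> complex_measurable (f \- g).
Proof.
move=> [fre fim] [gre gim]; split.
- rewrite (_ : (fun _ => _) =
    (fun t => complex.Re (f t)) \- (fun t => complex.Re (g t))).
    exact: measurable_funB.
  by apply/funext => t /=; case: (f t) (g t) => [? ?] [? ?].
- rewrite (_ : (fun _ => _) =
    (fun t => complex.Im (f t)) \- (fun t => complex.Im (g t))).
    exact: measurable_funB.
  by apply/funext => t /=; case: (f t) (g t) => [? ?] [? ?].
Qed.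

Lemma measurable_normc_powR p f : complex_measurable f ->
  measurable_fun setT (fun t => (ComplexField.Normc.normc (f t) `^ p)%:E).
Proof.
move=> [fre fim]; apply/measurable_EFinP.
apply: (measurableT_comp (measurable_powR p)).
rewrite (_ : (fun _ => _) = (@Num.sqrt R) \o
  (fun t => complex.Re (f t) ^+ 2 + complex.Im (f t) ^+ 2)).
  apply: measurableT_comp.
    by apply: continuous_measurable_fun => x; exact: sqrt_continuous.
  by apply: measurable_funD; exact: measurable_funX.
by apply/funext => t /=; case: (f t).
Qed.

Lemma Lp_int_eq0_ae mu p f : 0 < p -> complex_measurable f ->
  Lp_int mu p f = 0%E -> f = cst 0 %[ae mu].
Proof.
move=> p0 mf int0.
have : ae_eq mu setT (fun t => (ComplexField.Normc.normc (f t) `^ p)%:E)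
    (cst 0%E).
  apply/ae_eq_integral_abs => //; first exact: measurable_normc_powR.
  rewrite -int0; apply: eq_integral => t _.
  by rewrite gee0_abs// lee_fin powR_ge0.
apply: filterS => t /(_ I)/eqP; rewrite eqe powR_eq0 => /andP[/eqP + _] _.
exact: ComplexField.Normc.eq0_normc.
Qed.

Lemma eq_Lp_int_ae mu p f g : complex_measurable f -> complex_measurable g ->
  f = g %[ae mu] -> Lp_int mu p f = Lp_int mu p g.
Proof.
move=> mf mg fg; apply: ge0_ae_eq_integral => //.
- exact: measurable_normc_powR.
- exact: measurable_normc_powR.
- by move=> t _; rewrite lee_fin powR_ge0.
- by move=> t _; rewrite lee_fin powR_ge0.
- by apply: filterS fg => t /[apply] ->.
Qed.

End Lp_int_ae.

Theorem proposition3p8 (R : realType) (G : topologicalZmodType)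
    (Ghausdorff : hausdorff_space G) (Glocally_compact : locally_compact [set: G])
    (S : set G) (S_nonempty : S !=set0) (S_subset : S `<=` [set~ 0])
    (p : R) (p_gt0 : 0 < p)
    (mu : nat -> {finite_measure set (dual R G) -> \bar R})
    (mu_regular_nonzero : forall k, regular_nonzero (mu k))
    (mu_dominated : forall n, (0 < n)%N -> mu 0%N `<< mu n)
    (phi : nat -> dual R G -> R[i])
    (phi_projection : forall k,
      is_metric_projection (mu k) p (trig_poly S) (phi k))
    (best_error0 : best_error (mu 0%N) p (trig_poly S) = 0%E) :
  Lp_int (mu 0%N) p (cst 1 \- phi n) @[n --> \oo] -->
    best_error (mu 0%N) p (trig_poly S) ->
  Lp_int (mu 0%N) p (phi 0%N \- phi n) @[n --> \oo] --> 0%E.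
Proof.
rewrite best_error0.
have mphi k : complex_measurable (phi k) by case: (phi_projection k) => -[[]].
have m1 := @complex_measurable_cst _ (dual R G) R 1.
have [_ err0 _] := phi_projection 0%N.
have phi0 : phi 0%N = cst 1 %[ae mu 0%N].
  have : (cst 1 \- phi 0%N) = cst 0 %[ae mu 0%N].
    apply: (@Lp_int_eq0_ae _ _ _ _ p) => //; first exact: complex_measurableB.
    by rewrite -err0.
  by apply: filterS => g /[apply] /eqP; rewrite subr_eq0 => /eqP.
rewrite (_ : (fun n => Lp_int (mu 0%N) p (phi 0%N \- phi n)) =
  (fun n => Lp_int (mu 0%N) p (cst 1 \- phi n)))//.
apply/funext => n; apply: eq_Lp_int_ae; [exact: complex_measurableB..|].
by apply: filterS phi0 => g /[apply] /= ->.
Qed.
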